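(* Let $\Sigma_V,\Sigma_E$ be finite label sets, $\varepsilon_V,\varepsilon_E$ special labels, and let $G_n$ be the set of graphs with at most $n$ vertices, vertex labels in $\Sigma_V$ and edge labels in $\Sigma_E$. Let $c_V:(\Sigma_V\cup\{\varepsilon_V\})^2\to[0,\infty)$ and $c_E:(\Sigma_E\cup\{\varepsilon_E\})^2\to[0,\infty)$ be edit cost functions that are metrics on $\Sigma_V\cup\{\varepsilon_V\}$ and $\Sigma_E\cup\{\varepsilon_E\}$ respectively. Then there exist a Maximum Common Subelement (MCS) Model $(X,\preccurlyeq_X,s_X)$ and an injective function $\theta:G_n\to X$ such that for all $g_1,g_2\in G_n$, $$d_{\mathrm{GED}}(g_1,g_2)=s_X(\theta(g_1))+s_X(\theta(g_2))-2\,s'_X(\{\theta(g_1),\theta(g_2)\}).$$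
   Context: A graph is $g=(V,E,\ell_V,\ell_E)$ with $V$ finite, $E\subseteq[V]^2$ (2-element subsets of $V$), $\ell_V:V\to\Sigma_V$, $\ell_E:E\to\Sigma_E$. For $n\ge|V|$, the graph $n$-completion $\kappa_n^{\varepsilon_V,\varepsilon_E}(g)=(V',E',\ell'_V,\ell'_E)$ has $V'=V\cup\{v_1,\dots,v_{n-|V|}\}$ (new vertices), $E'=[V']^2$, $\ell'_V=\ell_V$ on $V$ and $\varepsilon_V$ on the new vertices, $\ell'_E=\ell_E$ on $E$ and $\varepsilon_E$ on $E'\setminus E$. Graph edit distance: for $g_1,g_2$ with vertex sets $V_1,V_2$, let $g'_i=\kappa_{|V_1|+|V_2|}^{\varepsilon_V,\varepsilon_E}(g_i)=(V'_i,E'_i,\ell'_{Vi},\ell'_{Ei})$, let $\mathcal F$ be the set of bijections $f:V'_1\to V'_2$, and $c(f)=\sum_{v\in V'_1}c_V(\ell'_{V1}(v),\ell'_{V2}(f(v)))+\sum_{e\in E'_1}c_E(\ell'_{E1}(e),\ell'_{E2}(f(e)))$, where $f(\{u,v\})=\{f(u),f(v)\}$; then $d_{\mathrm{GED}}(g_1,g_2)=\min_{f\in\mathcal F}c(f)$. For a partial order $\preccurlyeq$ on $X$ and $X'\subseteq X$, $cs(X')=\{x\in X: x\preccurlyeq y\ \forall y\in X'\}$. A size function on $(X,\preccurlyeq)$ is $s:X\to[0,\infty)$ with (S1) $x_1\preccurlyeq x_2\Rightarrow s(x_1)\le s(x_2)$ and (S2) $x_1\preccurlyeq x_2$, $s(x_1)=s(x_2)\Rightarrow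 x_1=x_2$. An MCS Model is a triple $(X,\preccurlyeq,s)$ with $\preccurlyeq$ a partial order on $X$, $s$ a size function, and (A1) for all $x_1,x_2$, $cs(\{x_1,x_2\})\ne\emptyset$ and $\{s(x)\mid x\in cs(\{x_1,x_2\})\}$ has a maximum; (A2) for all $x_1,x_2,x$ with $x_1,x_2\preccurlyeq x$ there is $x_{12}\in cs(\{x_1,x_2\})$ with $s(x)\ge s(x_1)+s(x_2)-s(x_{12})$. Also $s'_X(\{x_1,x_2\})=\max\{s_X(x):x\in cs(\{x_1,x_2\})\}$.
   Formalization: Graphs in G_n are taken up to isomorphism (θ(g1)=θ(g2) iff g1, g2 are isomorphic), since distinct isomorphic graphs have distance 0 and no θ can separate them; the special labels ε_V, ε_E are taken outside Σ_V, Σ_E, as the claim fails otherwise. *)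

(* Defs.v *)
From HB Require Import structures.
From mathcomp Require Import all_boot all_order all_algebra.
From mathcomp Require Import boolp classical_sets reals.

Set Implicit Arguments.
Unset Strict Implicit.
Unset Printing Implicit Defensive.

Import Order.TTheory GRing.Theory Num.Theory.

Local Open Scope classical_set_scope.
Local Open Scope ring_scope.

Section Extrema.
Variable R : realType.
Implicit Types (A : set R) (m : R).

Definition is_maximum A m := A m /\ ubound A m.
Definition is_minimum A m := A m /\ lbound A m.

(* Total operators: the value is 0 when the extremum is not attained. *)
Definition maximum A : R := xget 0 [set m | is_maximum A m].
Definition minimum A : R := xget 0 [set m | is_minimum A m].

Lemma maximumE A m : is_maximum A m -> maximum A = m.
Proof.
move=> Am; apply: (xget_unique 0 Am) => m' [Am' ub'].
by apply/le_anti; rewrite (ub' _ (proj1 Am)) (proj2 Am _ Am').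
Qed.

Lemma minimumE A m : is_minimum A m -> minimum A = m.
Proof.
move=> Am; apply: (xget_unique 0 Am) => m' [Am' lb'].
by apply/le_anti; rewrite (lb' _ (proj1 Am)) (proj2 Am _ Am').
Qed.

End Extrema.

Record is_metric (R : realType) (T : Type) (d : T -> T -> R) : Prop := {
  metric_ge0 : forall x y, 0 <= d x y;
  metric_eq0 : forall x y, d x y = 0 <-> x = y;
  metric_sym : forall x y, d x y = d y x;
  metric_triangle : forall x y z, d x z <= d x y + d y z
}.

Section MCSModel.
Variables (R : realType) (disp : Order.disp_t) (X : porderType disp).
Variable s : X -> R.

(* [lbound A] is the set of x with x <= y for all y in A. *)
Definition cs (A : set X) : set X := lbound A.

Record is_size_function : Prop := {
  size_ge0 : forall x, 0 <= s x;
  size_mono : forall x1 x2, (x1 <= x2)%O -> s x1 <= s x2;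
  size_strict : forall x1 x2, (x1 <= x2)%O -> s x1 = s x2 -> x1 = x2
}.

Record is_mcs_model : Prop := {
  mcs_size : is_size_function;
  mcs_A1 : forall x1 x2,
    cs [set x1; x2] !=set0 /\
    exists m, is_maximum [set s x | x in cs [set x1; x2]] m;
  mcs_A2 : forall x1 x2 x, (x1 <= x)%O -> (x2 <= x)%O ->
    exists2 x12, cs [set x1; x2] x12 & s x1 + s x2 - s x12 <= s x
}.

Definition mcs_size_max (A : set X) : R := maximum [set s x | x in cs A].

End MCSModel.

Record graph (SV SE : Type) := Graph {
  vertex : finType;
  edges : {set {set vertex}};
  edges_card2 : forall e, e \in edges -> #|e| = 2%N;
  vlabel : vertex -> SV;
  elabel : {e : {set vertex} | e \in edges} -> SE
}.

Definition elabel_opt (SV SE : Type) (g : graph SV SE) (e : {set vertex g}) :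
  option SE := omap (@elabel SV SE g) (insub e).

(* Equality of [elabel_opt] at [e] and [f @: e] says both that one is an edge
   exactly when the other is, and that their labels then agree. *)
Definition graph_iso (SV SE : Type) (g1 g2 : graph SV SE) : Prop :=
  exists f : vertex g1 -> vertex g2,
    [/\ bijective f,
        forall v, vlabel (f v) = vlabel v &
        forall e : {set vertex g1}, elabel_opt (f @: e) = elabel_opt e].

Section Completion.
Variables (SV SE : Type) (g : graph SV SE) (n : nat).

(* Original vertices are [inl v], new ones [inr i]; meant for
   [#|vertex g| <= n]. *)
Definition completion_vertex : finType :=
  (vertex g + 'I_(n - #|vertex g|))%type.

Definition completion_edges : {set {set completion_vertex}} :=
  [set e : {set completion_vertex} | #|e| == 2%N].

Lemma completion_edges_card2 (e : {set completion_vertex}) :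
  e \in completion_edges -> #|e| = 2%N.
Proof. by rewrite inE => /eqP. Qed.

(* The special labels are [None], so they lie outside SV and SE. *)
Definition completion_vlabel (v : completion_vertex) : option SV :=
  match v with inl u => Some (vlabel u) | inr _ => None end.

(* A 2-element set whose preimage under [inl] is an edge of g, hence has 2
   elements, is the copy of that edge; every other one gets [None]. *)
Definition completion_elabel
    (e : {e : {set completion_vertex} | e \in completion_edges}) : option SE :=
  elabel_opt (inl @^-1: val e).

Definition completion : graph (option SV) (option SE) :=
  Graph completion_edges_card2 completion_vlabel completion_elabel.

End Completion.

(* Edge label in a graph whose edge labels may be the special label; the
   default is never used on edges. *)
Definition elabel_eps (SV SE : Type) (g : graph (option SV) (option SE))
  (e : {set vertex g}) : option SE := odflt None (elabel_opt e).

Section GraphEditDistance.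
Variables (R : realType) (SV SE : Type).
Variables (cV : option SV -> option SV -> R) (cE : option SE -> option SE -> R).

(* For g1, g2 complete and f bijective, [f @: e] is an edge whenever [e] is. *)
Definition edit_cost (g1 g2 : graph (option SV) (option SE))
    (f : vertex g1 -> vertex g2) : R :=
  \sum_(v : vertex g1) cV (vlabel v) (vlabel (f v)) +
  \sum_(e in edges g1) cE (elabel_eps e) (elabel_eps (f @: e)).

Definition d_GED (g1 g2 : graph SV SE) : R :=
  let n := (#|vertex g1| + #|vertex g2|)%N in
  let g1' := completion g1 n in
  let g2' := completion g2 n in
  minimum [set edit_cost f | f in [set f : vertex g1' -> vertex g2' |
                                    bijective f]].

End GraphEditDistance.

Definition bounded_graph (SV SE : Type) (n : nat) : Type :=
  {g : graph SV SE | (#|vertex g| <= n)%N}.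

(* Main.v *)
Require Import Defs.
From HB Require Import structures.
From mathcomp Require Import all_boot all_order all_fingroup all_algebra.
From mathcomp Require Import boolp classical_sets reals.
From mathcomp Require Import lra.

Set Implicit Arguments.
Unset Strict Implicit.
Unset Printing Implicit Defensive.

Import Order.TTheory GRing.Theory Num.Theory.
Local Open Scope classical_set_scope.
Local Open Scope ring_scope.

(* Only two properties of the edit distance matter: up to isomorphism it is a
   metric, and it takes place on a finite set.

   Any finite metric space (I, d) embeds in an MCS model.  By Kuratowski, x is
   sent to the point d(x, -) of l^oo(I).  Take for X the balls of l^oo(I) of
   radius less than a bound B > d, ordered by reverse inclusion in the strong
   sense (c, r) <= (c', r') iff |c - c'| <= r - r', together with a bottom
   element, and let a ball have size B - r and the bottom size 0.  Two balls of
   l^oo meet as soon as their centers are no further apart than the sum of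
   their radii; hence x and y, seen as balls of radius 0, are contained in a
   common ball of radius d(x, y) / 2, which gives the formula, and two balls of
   radii r1, r2 containing a ball of radius r are contained in one of radius
   r1 + r2 - r, which gives (A2).  The bottom element takes over when that
   radius is B or more.

   Graphs with at most n vertices become points of a finite space when padded
   to labelings of 'I_(n + n).  The edit distance is the quotient, by
   permutations of 'I_(n + n), of an invariant pseudometric on labelings. *)

(** * Finite metric spaces in MCS models *)

Section FormalBalls.
Variables (R : realType) (I : finType) (B : R).

Local Notation ball := ({ffun I -> R} * R)%type.

(** [None] is the bottom element. The strict bound gives all other elements positive size, so that
    (S2) separates them from the bottom. *)
Definition formal_ball := option {p : ball | p.2 < B}.

HB.instance Definition _ := Choice.on formal_ball.

Implicit Types (x y z : formal_ball) (p q : ball).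

(** The radii are compared separately because [I] may be empty. *)
Definition ball_contains (p q : ball) : bool :=
  (q.2 <= p.2) && [forall i, `|p.1 i - q.1 i| <= p.2 - q.2].

Lemma ball_containsP p q :
  reflect (q.2 <= p.2 /\ forall i, `|p.1 i - q.1 i| <= p.2 - q.2)
          (ball_contains p q).
Proof. by apply: (iffP andP) => -[le_r /forallP]. Qed.

Definition formal_ball_le x y : bool :=
  match x, y with
  | None, _ => true
  | Some _, None => false
  | Some p, Some q => ball_contains (val p) (val q)
  end.

Lemma ball_contains_eq p q : ball_contains p q -> p.2 = q.2 -> p = q.
Proof.
case: p q => [f r] [g t] /ball_containsP[/= _ fg] rt; rewrite rt; congr (_, _).
apply/ffunP => i; apply/eqP.
by rewrite -subr_eq0 -normr_le0 (le_trans (fg i)) // rt subrr.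
Qed.

Lemma formal_ball_le_refl : reflexive formal_ball_le.
Proof.
case=> //= p; apply/ball_containsP; split=> // i.
by rewrite !subrr normr0.
Qed.

Lemma formal_ball_le_anti : antisymmetric formal_ball_le.
Proof.
move=> [p|] [q|] //= /andP[pq qp].
have [[le_qp _] [le_pq _]] := (ball_containsP _ _ pq, ball_containsP _ _ qp).
congr Some; apply/val_inj/ball_contains_eq => //.
by apply/le_anti; rewrite le_qp le_pq.
Qed.

Lemma formal_ball_le_trans : transitive formal_ball_le.
Proof.
move=> [[[g t] lt_t]|] [[[f r] lt_r]|] [[[h u] lt_u]|] //=.
move=> /ball_containsP[/= le_tr fg] /ball_containsP[/= le_ut gh].
apply/ball_containsP; split=> /= [|i]; first exact: le_trans le_tr.
apply: le_trans (ler_distD (g i) _ _) _; have := fg i; have := gh i; lra.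
Qed.

Fact formal_ball_display : Order.disp_t. Proof. exact: Order.Disp tt tt. Qed.

HB.instance Definition _ := Order.Le_isPOrder.Build formal_ball_display
  formal_ball formal_ball_le_refl formal_ball_le_anti formal_ball_le_trans.

Definition formal_ball_size x : R := if x is Some p then B - (val p).2 else 0.

Lemma formal_ball_leE x y : (x <= y)%O = formal_ball_le x y.
Proof. by []. Qed.

Lemma formal_ball_size_ge0 x : 0 <= formal_ball_size x.
Proof. by case: x => [[p /= /ltW]|] //; rewrite subr_ge0. Qed.

Lemma formal_ball_is_size_function : is_size_function formal_ball_size.
Proof.
split; first exact: formal_ball_size_ge0.
  move=> [p|] y; last by rewrite formal_ball_size_ge0.
  case: y => [q|] //; rewrite formal_ball_leE.
  by move=> /ball_containsP[le_r _] /=; lra.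
move=> [p|] [q|] //; rewrite formal_ball_leE /=.
  by move=> pq eq_s; congr Some; apply/val_inj/ball_contains_eq => //; lra.
by move=> _ eq_s; exfalso; have := valP q; lra.
Qed.

(** The least radius of a ball containing [p] and [q]. In coordinate [i], two intervals neither of
    which contains the other span a length [p.2 + q.2 + |p.1 i - q.1 i|]; the initial value of the
    maximum covers nested ones. *)
Definition hull_radius (p q : ball) : R :=
  \big[Num.max/Num.max p.2 q.2]_i ((p.2 + q.2 + `|p.1 i - q.1 i|) / 2).

Lemma hull_radius_leP p q t :
  reflect [/\ p.2 <= t, q.2 <= t &
              forall i, `|p.1 i - q.1 i| <= (t - p.2) + (t - q.2)]
          (hull_radius p q <= t).
Proof.
apply: (iffP (bigmax_leP _ _ _ _)) => [[]|[le_p le_q pq]].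
  rewrite ge_max => /andP[-> ->] pq; split=> // i; have := pq i isT; lra.
by rewrite ge_max le_p le_q; split=> // i _; have := pq i; lra.
Qed.

Lemma hull_radius_le_of_incl p q r :
  ball_contains r p -> ball_contains r q -> hull_radius p q <= r.2.
Proof.
move=> /ball_containsP[le_p rp] /ball_containsP[le_q rq].
apply/hull_radius_leP; split=> // i.
apply: le_trans (ler_distD (r.1 i) _ _) _.
by rewrite [X in X + _]distrC; apply: lerD.
Qed.

(** The center must lie in the balls of radii [t - p.2] and [t - q.2] around [p.1] and [q.1]; in
    each coordinate the larger left endpoint does. *)
Lemma hull_ball p q t : hull_radius p q <= t ->
  exists f, ball_contains (f, t) p && ball_contains (f, t) q.
Proof.
case/hull_radius_leP=> le_p le_q pq.
(* The coordinates of a common point can be chosen independently. *)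
exists [ffun i => Num.max (p.1 i - (t - p.2)) (q.1 i - (t - q.2))].
apply/andP; split; apply/ball_containsP; split=> //= i; rewrite ffunE ler_norml;
  case: (leP (p.1 i - (t - p.2))) => ?;
  move: (pq i); rewrite ler_norml => /andP[? ?]; apply/andP; split; lra.
Qed.

(** The value 0 is the size of [None], the only common lower bound once the hull radius reaches
    [B]. *)
Definition hull_size (p q : ball) : R :=
  Num.max 0 (B - hull_radius p q).

Lemma csP x y z : cs [set x; y] z <-> ((z <= x)%O /\ (z <= y)%O).
Proof.
by split=> [zxy|[zx zy] w [->|->]] //; split; apply: zxy; [left|right].
Qed.

Lemma hull_size_max (p q : {p : ball | p.2 < B}) :
  is_maximum
    [set formal_ball_size z | z in cs [set (Some p : formal_ball); Some q]]
    (hull_size (val p) (val q)).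
Proof.
split; last first.
  move=> _ [[r|] /csP[zp zq] <-] /=; last by rewrite le_max lexx.
  by rewrite le_max lerD2l lerN2 hull_radius_le_of_incl ?orbT.
rewrite /hull_size; case: ltP => [hB|_]; last first.
  by exists None => //; apply/csP.
have [f /andP[fp fq]] := hull_ball (lexx (hull_radius (val p) (val q))).
rewrite subr_gt0 in hB; exists (Some (exist _ (f, hull_radius _ _) hB)) => //.
by apply/csP.
Qed.

Lemma formal_ball_is_mcs_model : is_mcs_model formal_ball_size.
Proof.
split; first exact: formal_ball_is_size_function.
- move=> x y; split; first by exists None; apply/csP.
  have cs0 x' y' : (x' = None) \/ (y' = None) ->
      is_maximum [set formal_ball_size z | z in cs [set x'; y']] 0.
    move=> xy0; split; first by exists None => //; apply/csP.
    by move=> _ [[r|] /csP[rx ry] <-] //; case: xy0 rx ry => ->.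
  case: x => [p|]; last by exists 0; apply: cs0; left.
  case: y => [q|]; last by exists 0; apply: cs0; right.
  by exists (hull_size (val p) (val q)); apply: hull_size_max.
- have size_le := size_mono formal_ball_is_size_function.
  move=> x y z xz yz.
  case: x xz => [p|] xz; last first.
    exists None; first exact/csP.
    by rewrite /= add0r subr0 size_le.
  case: y yz => [q|] yz; last first.
    exists None; first exact/csP.
    by rewrite /= addr0 subr0 (size_le (Some p)).
  case: z xz yz => [r|] //.
  rewrite !formal_ball_leE => /ball_containsP[rp pr] /ball_containsP[rq qr].
  (* With this radius (A2) becomes an equality. *)
  pose t := (val p).2 + (val q).2 - (val r).2.
  have : hull_radius (val p) (val q) <= t.
    apply/hull_radius_leP; split; rewrite /t; try lra.
    move=> i; apply: le_trans (ler_distD ((val r).1 i) _ _) _.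
    have := pr i; have := qr i; rewrite [in X in X -> _]distrC; lra.
  case/hull_ball=> f /andP[fp fq].
  have [tB|tB] := ltP t B; last first.
    by exists None; [exact/csP | rewrite /t in tB; rewrite /=; lra].
  exists (Some (exist _ (f, t) tB)); first exact/csP.
  by rewrite /= /t; lra.
Qed.

End FormalBalls.

(** A pseudometric is allowed because distinct labelings of isomorphic graphs are at distance 0; the
    Kuratowski map identifies them. *)
Lemma finite_pseudometric_mcs (R : realType) (I : finType) (d : I -> I -> R) :
  (forall x, d x x = 0) -> (forall x y, d x y = d y x) ->
  (forall x y z, d x z <= d x y + d y z) ->
  exists (disp : Order.disp_t) (X : porderType disp) (s : X -> R),
    is_mcs_model s /\
    exists theta : I -> X,
      (forall x y, theta x = theta y <-> d x y = 0) /\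
      (forall x y, d x y =
        s (theta x) + s (theta y) - 2 * mcs_size_max s [set theta x; theta y]).
Proof.
move=> dxx dC dtri.
have d_ge0 x y : 0 <= d x y by have := dtri x y x; rewrite dxx [d y x]dC; lra.
(* Positivity of [B] admits the balls of radius 0; exceeding every distance keeps the hulls of
   radius [d x y / 2] above the bottom. *)
pose B := 1 + \sum_x \sum_y d x y.
have dB x y : d x y < B.
  rewrite /B (bigD1 x) //= (bigD1 y) //=.
  have sum0 u : 0 <= \sum_(v | v != y) d u v by apply: sumr_ge0.
  have : 0 <= \sum_(u | u != x) \sum_v d u v.
    by apply: sumr_ge0 => u _; apply: sumr_ge0.
  have := sum0 x; lra.
have B0 : 0 < B.
  by rewrite /B ltr_pwDl // sumr_ge0 // => x _; apply: sumr_ge0.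
exists _, (formal_ball I B), (@formal_ball_size _ _ _).
split; first exact: formal_ball_is_mcs_model.
pose emb x : {ffun I -> R} := [ffun y => d x y].
pose theta x : formal_ball I B := Some (exist _ (emb x, 0) B0).
exists theta; split=> x y.
  split=> [[/ffunP/(_ y)]|dxy]; first by rewrite !ffunE dxx.
  congr Some; apply: val_inj; congr (_, _); apply/ffunP => z; rewrite !ffunE.
  apply/le_anti; have := dtri x y z; have := dtri y x z.
  by rewrite [d y x]dC dxy !add0r => -> ->.
rewrite /mcs_size_max (maximumE (hull_size_max _ _)) /= /hull_size /=.
suff -> : hull_radius (emb x, 0) (emb y, 0) = d x y / 2.
  by rewrite max_r; have := dB x y; have := d_ge0 x y; lra.
(* By the triangle inequality the centers differ by at most [d x y] in each coordinate, and
   coordinate [y] attains this. *)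
apply/le_anti/andP; split.
  apply/hull_radius_leP; split=> /=; rewrite ?divr_ge0 // => z.
  rewrite !ffunE ler_norml; have := dtri x y z; have := dtri y x z.
  by rewrite [d y x]dC; lra.
have /hull_radius_leP[_ _ /(_ y)] := lexx (hull_radius (emb x, 0) (emb y, 0)).
by rewrite !ffunE dxx subr0 ger0_norm //=; lra.
Qed.

(** * Distances between labelings *)

Lemma finite_minimum (R : realType) (I : finType) (F : I -> R) (i0 : I) :
  is_minimum (range F) (minimum (range F)).
Proof.
have [i _ Fi] : exists2 i, true & forall j, F i <= F j.
  case: (@arg_minP _ _ _ i0 xpredT F) => // i _ Fi.
  by exists i => // j; apply: Fi.
suff Fmin : is_minimum (range F) (F i) by rewrite (minimumE Fmin).
by split=> [|_ [j _ <-]]; [exists i | apply: Fi].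
Qed.

Lemma big_inj_codom (R : nmodType) (I J : finType) (h : I -> J) (P : pred J)
    (F : J -> R) :
  injective h -> (forall j, P j -> j \notin codom h -> F j = 0) ->
  \sum_(j | P j) F j = \sum_(i | P (h i)) F (h i).
Proof.
move=> h_inj F0; rewrite (bigID [in codom h]) /= [X in _ + X]big1 => [|j].
  rewrite addr0 (reindex_omap h (fun j => [pick i | h i == j])) /= => [|j].
    apply: eq_bigl => i; rewrite codom_f andbT; case: pickP => [i' /eqP|/(_ i)].
      by move/h_inj->; rewrite eqxx andbT.
    by rewrite eqxx.
  case/andP=> _ /codomP[i ->]; case: pickP => [i' /eqP <- //|/(_ i)].
  by rewrite eqxx.
by case/andP; apply: F0.
Qed.

Section Labelings.
Variables (R : realType) (SV SE : finType).
Variables (cV : option SV -> option SV -> R) (cE : option SE -> option SE -> R).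
Hypotheses (cV_metric : is_metric cV) (cE_metric : is_metric cE).

(** [None] marks padding vertices and pairs that are not edges. The second component is read by
    [labeling_cost] on pairs only. *)
Definition labeling (T : finType) : finType :=
  ({ffun T -> option SV} * {ffun {set T} -> option SE})%type.

Definition labeling_cost (T : finType) (c1 c2 : labeling T) : R :=
  \sum_u cV (c1.1 u) (c2.1 u) +
  \sum_(e : {set T} | #|e| == 2%N) cE (c1.2 e) (c2.2 e).

Definition relabel (T U : finType) (f : T -> U) (c : labeling U) : labeling T :=
  ([ffun u => c.1 (f u)], [ffun e : {set T} => c.2 (f @: e)]).

Lemma relabel_comp (T U W : finType) (f : T -> U) (g : U -> W) c :
  relabel f (relabel g c) = relabel (g \o f) c.
Proof.
by congr (_, _); apply/ffunP => x; rewrite !ffunE //= imset_comp.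
Qed.

Lemma eq_relabel (T U : finType) (f g : T -> U) (c : labeling U) :
  f =1 g -> relabel f c = relabel g c.
Proof.
move=> fg; congr (_, _); apply/ffunP => x.
  by rewrite !ffunE fg.
by rewrite !ffunE (eq_imset _ fg).
Qed.

Lemma relabel_id (T : finType) (f : T -> T) c : f =1 id -> relabel f c = c.
Proof.
move=> f_id; case: c => cl ce; congr (_, _); apply/ffunP => x.
  by rewrite !ffunE f_id.
by rewrite !ffunE (eq_imset _ f_id) imset_id.
Qed.

Lemma labeling_cost_ge0 T (c1 c2 : labeling T) : 0 <= labeling_cost c1 c2.
Proof.
apply: addr_ge0; apply: sumr_ge0 => x _.
  exact: metric_ge0 cV_metric _ _.
exact: metric_ge0 cE_metric _ _.
Qed.

Lemma labeling_cost_eq0P T (c1 c2 : labeling T) :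
  labeling_cost c1 c2 = 0 <->
    c1.1 = c2.1 /\ forall e : {set T}, #|e| = 2%N -> c1.2 e = c2.2 e.
Proof.
have cV0 := metric_ge0 cV_metric; have cE0 := metric_ge0 cE_metric.
rewrite /labeling_cost; split=> [/eqP|[-> eq_e]]; last first.
  rewrite !big1 ?addr0 // => [e /eqP/eq_e ->|u _].
    exact/(metric_eq0 cE_metric).
  exact/(metric_eq0 cV_metric).
rewrite paddr_eq0 ?sumr_ge0 // => /andP[/eqP sV0 /eqP sE0]; split.
  apply/ffunP => u; apply/(metric_eq0 cV_metric).
  exact: (psumr_eq0P _ sV0).
move=> e /eqP e2; apply/(metric_eq0 cE_metric).
exact: (psumr_eq0P _ sE0).
Qed.

Lemma labeling_costC T (c1 c2 : labeling T) :
  labeling_cost c1 c2 = labeling_cost c2 c1.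
Proof.
congr (_ + _); apply: eq_bigr => x _.
  exact: metric_sym cV_metric _ _.
exact: metric_sym cE_metric _ _.
Qed.

Lemma labeling_cost_triangle T (c1 c2 c3 : labeling T) :
  labeling_cost c1 c3 <= labeling_cost c1 c2 + labeling_cost c2 c3.
Proof.
rewrite /labeling_cost addrACA -!big_split /=.
by apply: lerD; apply: ler_sum => x _; [apply: (metric_triangle cV_metric) |
  apply: (metric_triangle cE_metric)].
Qed.

(** Terms outside the image of [f] compare equal labels and vanish; [f] matches the others one to
    one. *)
Lemma labeling_cost_relabel (T U : finType) (f : T -> U) (c1 c2 : labeling U) :
  injective f ->
  (forall u, u \notin codom f -> c1.1 u = c2.1 u) ->
  (forall e : {set U}, #|e| = 2%N -> ~~ (e \subset codom f) ->
    c1.2 e = c2.2 e) ->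
  labeling_cost (relabel f c1) (relabel f c2) = labeling_cost c1 c2.
Proof.
move=> f_inj eq_v eq_e; congr (_ + _).
  rewrite [RHS](big_inj_codom f_inj) => [|u _ /eq_v ->]; last first.
    exact/(metric_eq0 cV_metric).
  by apply: eq_bigr => u _; rewrite !ffunE.
rewrite [RHS](big_inj_codom (imset_inj f_inj)) => [|e /eqP e2 fe].
  by apply: eq_big => e; rewrite ?card_imset // !ffunE.
rewrite eq_e //; first exact/(metric_eq0 cE_metric).
apply: contra fe => /fintype.subsetP fe.
apply/codomP; exists (f @^-1: e)%SET.
apply/setP => u; apply/idP/imsetP => [eu|[v + ->]]; last by rewrite inE.
by have /codomP[v uv] := fe u eu; exists v; rewrite // inE -uv.
Qed.

Definition labeling_dist (T : finType) (c1 c2 : labeling T) : R :=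
  minimum (range (fun s : {perm T} => labeling_cost c1 (relabel s c2))).

Lemma labeling_distP T (c1 c2 : labeling T) :
  (forall s : {perm T}, labeling_dist c1 c2 <= labeling_cost c1 (relabel s c2))
  /\ exists s : {perm T}, labeling_cost c1 (relabel s c2) = labeling_dist c1 c2.
Proof.
have [[s _ cs] lb] := finite_minimum
  (fun s : {perm T} => labeling_cost c1 (relabel s c2)) 1%g.
by split; [move=> t; apply: lb; exists t | exists s].
Qed.

Lemma labeling_cost_perm (T : finType) (s : {perm T}) (c1 c2 : labeling T) :
  labeling_cost (relabel s c1) (relabel s c2) = labeling_cost c1 c2.
Proof.
have s_codom u : u \in codom s by rewrite -[u](permKV s) codom_f.
apply: labeling_cost_relabel => [|u|e _]; [exact: perm_inj | |].
  by rewrite s_codom.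
by case/negP; apply/fintype.subsetP.
Qed.

Lemma labeling_dist_refl T (c : labeling T) : labeling_dist c c = 0.
Proof.
have [lb [s cs]] := labeling_distP c c; apply/le_anti.
rewrite -[X in _ && (_ <= X)]cs labeling_cost_ge0 andbT.
apply: le_trans (lb 1%g) _.
rewrite relabel_id => [|u]; last by rewrite perm1.
by have [_ -> //] := labeling_cost_eq0P c c.
Qed.

Lemma labeling_distC T (c1 c2 : labeling T) :
  labeling_dist c1 c2 = labeling_dist c2 c1.
Proof.
suff le_d (c c' : labeling T) : labeling_dist c c' <= labeling_dist c' c.
  by apply/le_anti/andP.
have [_ [s <-]] := labeling_distP c' c.
have [/(_ s^-1%g) lb _] := labeling_distP c c'.
rewrite -(labeling_cost_perm s) relabel_comp labeling_costC in lb.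
by rewrite [relabel (_ \o _) _]relabel_id // in lb => u; rewrite /= permK.
Qed.

Lemma labeling_dist_triangle T (c1 c2 c3 : labeling T) :
  labeling_dist c1 c3 <= labeling_dist c1 c2 + labeling_dist c2 c3.
Proof.
have [_ [s <-]] := labeling_distP c1 c2.
have [_ [t <-]] := labeling_distP c2 c3.
(* Invariance makes [relabel s c2] the intermediate point of both costs; [s * t] acts as
   [t \o s]. *)
rewrite -(labeling_cost_perm s c2).
apply: le_trans (labeling_cost_triangle _ _ _).
rewrite relabel_comp; have [/(_ (s * t)%g) lb _] := labeling_distP c1 c3.
by rewrite (eq_relabel (g := t \o s)) // in lb => u; rewrite /= permM.
Qed.

End Labelings.

(** * Graphs as labelings *)

(** List [A] and [B], each starting with its copy of [V] in the order of [enum V], and match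
    positions. *)
Lemma injection_extension (V A B : finType) (k : V -> A) (h : V -> B) :
  injective k -> injective h -> (#|A| <= #|B|)%N ->
  exists2 f : A -> B, injective f & forall v, f (k v) = h v.
Proof.
move=> k_inj h_inj leAB.
have [x0 _|A0] := pickP (@predT A); last first.
  have noA (x : A) : False by have := A0 x.
  by exists (fun x => False_rect B (noA x)) => [x|v]; case: (noA _).
have /card_gt0P[b0 _] : (0 < #|B|)%N.
  by apply: leq_trans leAB; apply/card_gt0P; exists x0.
pose s (T : finType) (j : V -> T) := codom j ++ enum [predC codom j].
have s_uniq T j : injective j -> uniq (@s T j).
  move=> j_inj; rewrite cat_uniq enum_uniq andbT; apply/andP; split.
    by rewrite map_inj_uniq ?enum_uniq.
  by apply/hasPn => x; rewrite mem_enum.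
have mem_s T j x : x \in @s T j.
  by rewrite mem_cat mem_enum inE orbN.
have size_s T j : injective j -> size (@s T j) = #|T|.
  by move=> /s_uniq/card_uniqP <-; apply: eq_card => x; rewrite mem_s.
exists (fun x => nth b0 (s _ h) (index x (s _ k))) => [x y /eqP|v].
  have lt_index z : (index z (s _ k) < size (s _ h))%N.
    by rewrite size_s // (leq_trans _ leAB) // -(size_s _ k) // index_mem.
  rewrite nth_uniq ?s_uniq // => /eqP eq_index.
  by rewrite -(nth_index x (mem_s _ k x)) eq_index nth_index.
have v_enum : v \in enum V by rewrite mem_enum.
rewrite index_cat codom_f index_map // nth_cat size_map index_mem v_enum.
by rewrite (nth_map v) ?index_mem // nth_index.
Qed.

Section Padding.
Variables (SV SE : finType) (g : graph SV SE).

Lemma elabel_opt_card (e : {set vertex g}) :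
  #|e| <> 2%N -> elabel_opt e = None.
Proof.
by move=> e2; rewrite /elabel_opt insubN //; apply/negP => /edges_card2.
Qed.

(** A pair that leaves the image of [a] has a preimage with fewer than two elements, hence the label
    [None]. *)
Definition pad (U : finType) (a : vertex g -> U) : labeling SV SE U :=
  ([ffun u => omap (@vlabel SV SE g) [pick v | a v == u]],
   [ffun e : {set U} => elabel_opt (a @^-1: e)%SET]).

Variables (U : finType) (a : vertex g -> U).
Hypothesis a_inj : injective a.

Lemma pad_vertex v : (pad a).1 (a v) = Some (vlabel v).
Proof.
rewrite ffunE; case: pickP => [v' /eqP/a_inj -> //|/(_ v)].
by rewrite eqxx.
Qed.

Lemma pad_vertex_out u : u \notin codom a -> (pad a).1 u = None.
Proof.
move=> ua; rewrite ffunE; case: pickP => // v /eqP av.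
by rewrite -av codom_f in ua.
Qed.

Lemma pad_edge (e : {set vertex g}) : (pad a).2 (a @: e) = elabel_opt e.
Proof.
by rewrite ffunE; congr elabel_opt; apply/setP => v; rewrite inE mem_imset.
Qed.

Lemma pad_edge_out (e : {set U}) :
  #|e| = 2%N -> ~~ (e \subset codom a) -> (pad a).2 e = None.
Proof.
move=> e2 ea; rewrite ffunE elabel_opt_card // => ae2.
case/negP: ea; have <- : a @: (a @^-1: e)%SET = e.
  apply/eqP; rewrite eqEcard card_imset // ae2 e2 andbT.
  by apply/fintype.subsetP => _ /imsetP[v + ->]; rewrite inE.
by apply/fintype.subsetP => _ /imsetP[v _ ->]; rewrite codom_f.
Qed.

(** This absorbs a bijection or permutation into the placement of a graph: the preimage of [f @: e]
    under an injective [f] is [e]. *)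
Lemma relabel_pad (W : finType) (f : U -> W) :
  injective f -> relabel f (pad (f \o a)) = pad a.
Proof.
move=> f_inj; congr (_, _); apply/ffunP => x; rewrite !ffunE.
  by congr omap; apply: eq_pick => v /=; rewrite (inj_eq f_inj).
by congr elabel_opt; apply/setP => v; rewrite !inE /= (mem_imset _ _ f_inj).
Qed.

End Padding.

(** * Edit distance and isomorphism in terms of padded labelings *)

Section GED.
Variables (R : realType) (SV SE : finType).
Variables (cV : option SV -> option SV -> R) (cE : option SE -> option SE -> R).
Hypotheses (cV_metric : is_metric cV) (cE_metric : is_metric cE).
Variables g1 g2 : graph SV SE.

Local Notation lcost := (labeling_cost cV cE).

(** Whatever lies outside the image of [f] is padding for both graphs and costs nothing. *)
Lemma pad_cost_comp (T U : finType) (f : T -> U) (a : vertex g1 -> T)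
    (b : vertex g2 -> T) : injective f -> injective a -> injective b ->
  lcost (pad (f \o a)) (pad (f \o b)) = lcost (pad a) (pad b).
Proof.
move=> f_inj a_inj b_inj.
have out (g : graph SV SE) (c : vertex g -> T) u :
    u \notin codom f -> u \notin codom (f \o c).
  by apply: contra => /codomP[v ->]; apply: codom_f.
have outS (g : graph SV SE) (c : vertex g -> T) (e : {set U}) :
    ~~ (e \subset codom f) -> ~~ (e \subset codom (f \o c)).
  apply: contra => /fintype.subsetP ec; apply/fintype.subsetP => u /ec.
  by apply: contraLR; apply: out.
rewrite -(labeling_cost_relabel cV_metric cE_metric f_inj) ?relabel_pad //.
- by move=> u uf; rewrite !pad_vertex_out ?out.
- move=> e e2 ef; rewrite !pad_edge_out ?outS //; exact: inj_comp.
Qed.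

(** A completion is the padding along [inl]; injectivity of [f] sends pairs to pairs, where both
    edge labels agree. *)
Lemma edit_cost_pad n
    (f : vertex (completion g1 n) -> vertex (completion g2 n)) :
  injective f ->
  edit_cost cV cE f =
  lcost (@pad _ _ g1 (completion_vertex g1 n) inl)
        (relabel f (@pad _ _ g2 (completion_vertex g2 n) inl)).
Proof.
have inl_inj (A B : finType) : injective (@inl A B) by move=> x y [].
have vlabel_pad g (u : completion_vertex g n) :
    completion_vlabel u = (@pad SV SE g (completion_vertex g n) inl).1 u.
  case: u => [v|i]; first by rewrite (pad_vertex (@inl_inj _ _)).
  by rewrite pad_vertex_out //; apply/negP => /codomP[v].
have elabel_pad g (e : {set completion_vertex g n}) : #|e| = 2%N ->
    @elabel_eps _ _ (completion g n) e =
    (@pad SV SE g (completion_vertex g n) inl).2 e.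
  move=> /eqP e2; rewrite /elabel_eps /elabel_opt insubT /= ?inE // => eE.
  by rewrite /completion_elabel ffunE.
move=> f_inj; congr (_ + _).
  apply: eq_bigr => u _; congr cV; first exact: vlabel_pad.
  by rewrite [RHS]ffunE; apply: vlabel_pad.
apply: eq_big => e /=; first by rewrite inE.
rewrite inE => /eqP e2; congr cE; first exact: elabel_pad.
by rewrite [RHS]ffunE; apply: elabel_pad; rewrite card_imset.
Qed.

(* All that a bijection of the completions contributes to its edit cost is how
   it overlays the two graphs; this does not depend on the number of padding
   vertices once there are enough of them. *)
Lemma d_GED_labeling_dist (U : finType) (a1 : vertex g1 -> U)
    (a2 : vertex g2 -> U) : injective a1 -> injective a2 ->
  (#|vertex g1| + #|vertex g2| <= #|U|)%N ->
  d_GED cV cE g1 g2 = labeling_dist cV cE (pad a1) (pad a2).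
Proof.
move=> a1_inj a2_inj leU; rewrite /d_GED /labeling_dist; congr minimum.
set n := (_ + _)%N in leU *.
have card_cv (g : graph SV SE) :
    (#|vertex g| <= n)%N -> #|completion_vertex g n| = n.
  by move=> le_n; rewrite card_sum card_ord subnKC.
have card1 := card_cv g1 (leq_addr _ _).
have card2 := card_cv g2 (leq_addl _ _).
set T1 := completion_vertex g1 n in card1 *.
set T2 := completion_vertex g2 n in card2 *.
pose i1 : vertex g1 -> T1 := inl; pose i2 : vertex g2 -> T2 := inl.
have i1_inj : injective i1 by move=> x y [].
have i2_inj : injective i2 by move=> x y [].
apply/seteqP; split.
  move=> _ [f [h fK hK] <-]; rewrite edit_cost_pad; last exact: can_inj fK.
  have -> : pad i2 = pad (f \o (h \o i2)).
    by congr pad; apply/funext => v /=; rewrite hK.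
  have h_inj := can_inj hK; have f_inj := can_inj fK.
  have hi_inj : injective (h \o i2) by apply: inj_comp.
  rewrite relabel_pad //.
  have leT1 : (#|T1| <= #|U|)%N by rewrite card1.
  (* [w] carries the overlay into [U] with [g1] placed by [a1]; the permutation [s] then moves the
     copy of [g2] onto [a2]. *)
  have [w w_inj wE] := injection_extension i1_inj a1_inj leT1.
  have whi_inj : injective (w \o (h \o i2)) by apply: inj_comp.
  have [s s_inj sE] := injection_extension whi_inj a2_inj (leqnn _).
  exists (perm s_inj) => //.
  have -> : pad a2 = pad (perm s_inj \o (w \o (h \o i2))).
    by congr pad; apply/funext => v; rewrite /= permE sE.
  rewrite relabel_pad //; last exact: perm_inj.
  have -> : pad a1 = pad (w \o i1).
    by congr pad; apply/funext => v /=; rewrite wE.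
  exact: pad_cost_comp.
move=> _ [s _ <-]; pose b := (s^-1)%g \o a2.
have b_inj : injective b by apply: inj_comp => //; apply: perm_inj.
have -> : pad a2 = pad (s \o b).
  by congr pad; apply/funext => v /=; rewrite permKV.
rewrite relabel_pad //; last exact: perm_inj.
(* Conversely, the points of [U] occupied by the overlay number at most [n], so they fit in a
   completion even if [U] is larger. *)
pose S := [set u in codom a1 ++ codom b]%SET.
have leS : (#|{: {u | u \in S}}| <= #|T1|)%N.
  rewrite card_sig card1 cardsE (leq_trans (card_size _)) //.
  by rewrite size_cat !size_codom.
have a1S v : a1 v \in S by rewrite inE mem_cat codom_f.
have bS v : b v \in S by rewrite inE mem_cat codom_f orbT.
pose a1' v : {u | u \in S} := exist _ (a1 v) (a1S v).
pose b' v : {u | u \in S} := exist _ (b v) (bS v).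
have a1'_inj : injective a1' by move=> x y [/a1_inj].
have b'_inj : injective b' by move=> x y [/b_inj].
(* [k] places the overlay in the completion of [g1], [w] maps it back into [U], and [f] is the
   bijection of completions that realizes it. *)
have [k k_inj kE] := injection_extension a1'_inj i1_inj leS.
have leT1 : (#|T1| <= #|U|)%N by rewrite card1.
have [w w_inj wE] := injection_extension k_inj val_inj leT1.
have kb_inj : injective (k \o b') by apply: inj_comp.
have le12 : (#|T1| <= #|T2|)%N by rewrite card1 card2.
have [f f_inj fE] := injection_extension kb_inj i2_inj le12.
exists f; first by apply: inj_card_bij => //; rewrite card1 card2.
rewrite edit_cost_pad //.
have -> : pad i2 = pad (f \o (k \o b')).
  by congr pad; apply/funext => v; rewrite /= -fE.
rewrite relabel_pad // -(pad_cost_comp w_inj i1_inj kb_inj).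
have -> : w \o i1 = a1 by apply/funext => v; rewrite /= -kE wE.
by have -> : w \o (k \o b') = b by apply/funext => v; rewrite /= wE.
Qed.

(** At cost 0 all labels agree, and a vertex of a graph never has the label [None]; so an optimal
    permutation maps the vertices of [g1] onto those of [g2]. *)
Lemma labeling_dist_pad_eq0P (U : finType) (a1 : vertex g1 -> U)
    (a2 : vertex g2 -> U) : injective a1 -> injective a2 ->
  labeling_dist cV cE (pad a1) (pad a2) = 0 <-> graph_iso g1 g2.
Proof.
move=> a1_inj a2_inj.
have [lb [s cs]] := labeling_distP cV cE (pad a1) (pad a2); split.
  rewrite -cs => /labeling_cost_eq0P[]// /ffunP eq_v eq_e.
  have im v : {w | s (a1 v) = a2 w}.
    have := eq_v (a1 v); rewrite pad_vertex // ffunE.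
    have [/codomP/cid[w ->]|/pad_vertex_out->//] :=
      boolP (s (a1 v) \in codom a2).
    by exists w.
  have im' w : {v | s (a1 v) = a2 w}.
    have := eq_v ((s^-1)%g (a2 w)); rewrite [RHS]ffunE permKV pad_vertex //.
    have [/codomP/cid[v av]|/pad_vertex_out->//] :=
      boolP ((s^-1)%g (a2 w) \in codom a1).
    by exists v; rewrite -av permKV.
  pose f v := sval (im v); have fE v : s (a1 v) = a2 (f v) := svalP (im v).
  exists f; split.
  - exists (fun w => sval (im' w)) => [v|w].
      by apply: a1_inj; apply: (@perm_inj _ s); rewrite (svalP (im' _)) fE.
    by apply: a2_inj; rewrite -fE (svalP (im' w)).
  - move=> v; have := eq_v (a1 v).
    by rewrite pad_vertex // ffunE fE pad_vertex // => -[].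
  - have f_inj : injective f.
      by move=> x y fxy; apply: a1_inj; apply: (@perm_inj _ s); rewrite !fE fxy.
    move=> e; have [e2|e2] := eqVneq #|e| 2%N; last first.
      by rewrite !elabel_opt_card // ?card_imset //; apply/eqP.
    have := eq_e (a1 @: e); rewrite card_imset // pad_edge // ffunE => -> //.
    rewrite -(pad_edge a2_inj) -!imset_comp; congr ((pad a2).2 _).
    by apply: eq_imset => v /=.
case=> f [f_bij f_v f_e]; have f_inj := bij_inj f_bij.
have af_inj : injective (a2 \o f) by apply: inj_comp.
(* The isomorphism extends to a permutation of [U], whose cost is 0. *)
have [t t_inj tE] := injection_extension a1_inj af_inj (leqnn _).
apply/le_anti; rewrite -[X in _ && (_ <= X)]cs labeling_cost_ge0 // andbT.
apply: le_trans (lb (perm t_inj)) _.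
rewrite le_eqVlt; apply/orP; left; apply/eqP.
apply/labeling_cost_eq0P => //.
have [h fK hK] := f_bij.
have -> : pad a2 = pad (perm t_inj \o (a1 \o h)).
  by congr pad; apply/funext => v /=; rewrite permE tE /= hK.
rewrite relabel_pad; last exact: perm_inj.
split=> [|e _]; last first.
  rewrite !ffunE -f_e; congr elabel_opt; apply/setP => v.
  by rewrite inE -{1}(hK v) mem_imset // inE.
apply/ffunP => u; have [/codomP[v ->]|ua] := boolP (u \in codom a1).
  rewrite pad_vertex // -[in RHS](fK v) (@pad_vertex _ _ _ _ (a1 \o h)) ?f_v //.
  exact: inj_comp (can_inj hK).
rewrite !pad_vertex_out //; apply: contra ua => /codomP[v ->]; exact: codom_f.
Qed.

End GED.

Theorem theorem5 (R : realType) (SV SE : finType) (n : nat)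
    (cV : option SV -> option SV -> R) (cE : option SE -> option SE -> R)
    (cV_metric : is_metric cV) (cE_metric : is_metric cE) :
  exists (disp : Order.disp_t) (X : porderType disp) (s : X -> R),
    is_mcs_model s /\
    exists theta : bounded_graph SV SE n -> X,
      (* theta is well defined and injective on isomorphism classes *)
      (forall g1 g2, theta g1 = theta g2 <-> graph_iso (sval g1) (sval g2)) /\
      (forall g1 g2 : bounded_graph SV SE n,
        d_GED cV cE (sval g1) (sval g2) =
        s (theta g1) + s (theta g2)
          - 2 * mcs_size_max s [set theta g1; theta g2]).
Proof.
have [disp [X [s [s_mcs [theta [theta0 thetaE]]]]]] := finite_pseudometric_mcs
  (labeling_dist_refl (T := 'I_(n + n)) cV_metric cE_metric)
  (labeling_distC (T := 'I_(n + n)) cV_metric cE_metric)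
  (labeling_dist_triangle (T := 'I_(n + n)) cV_metric cE_metric).
exists disp, X, s; split=> //.
(* One set of [n + n] points serves all graphs and has room for any two of them side by side. *)
pose emb (g : bounded_graph SV SE n) v : 'I_(n + n) :=
  widen_ord (leq_trans (svalP g) (leq_addr n n)) (enum_rank v).
have emb_inj g : injective (emb g).
  by move=> v w [/ord_inj/enum_rank_inj].
exists (fun g => theta (pad (emb g))); split=> g1 g2.
  rewrite theta0; exact: labeling_dist_pad_eq0P.
rewrite -thetaE; apply: d_GED_labeling_dist => //.
by rewrite card_ord leq_add ?(svalP g1) ?(svalP g2).
Qed.
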